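(* Let $G$ be a simple connected graph with at least one edge and let $n\ge 1$. Let $\mathcal{L}_m$ denote the normalized Laplacian matrix of the $m$-th hexagonal graph $H_m(G)$, and let $N_m$ and $E_m$ denote the order and size of $H_m(G)$. The normalized Laplacian spectrum of $H_n(G)$ is given by the following. (i) If $\sigma$ is an eigenvalue of $\mathcal{L}_{n-1}$ with $\sigma\neq 0,2$, then $\lambda_1,\lambda_2,\lambda_3$ are eigenvalues of $\mathcal{L}_n$ with $m_{\mathcal{L}_n}(\lambda_1)=m_{\mathcal{L}_n}(\lambda_2)=m_{\mathcal{L}_n}(\lambda_3)=m_{\mathcal{L}_{n-1}}(\sigma)$, where $\lambda_1,\lambda_2,\lambda_3$ are the roots (in $\lambda$) of $$4\lambda^3-(10+2\sigma)\lambda^2+(5+4\sigma)\lambda-\sigma=0.$$ (ii) $0$ is an eigenvalue of $\mathcal{L}_n$ with multiplicity $1$; and $2$ is an eigenvalue of $\mathcal{L}_n$ with multiplicity $1$ if $G$ is bipartite. (iii) $\frac12$ and $\frac32$ are eigenvalues of $\mathcal{L}_n$, each with multiplicity $N_{n-1}$. (iv) $\frac{5-\sqrt5}{4}$ and $\frac{5+\sqrt5}{4}$ are eigenvalues of $\mathcal{L}_n$, each with multiplicity $E_{n-1}-N_{n-1}+1$. (v) If $G$ is bipartite, $\frac{3-\sqrt5}{4}$ and $\frac{3+\sqrt5}{4}$ are eigenvalues of $\mathcal{L}_n$, each with multiplicity $E_{n-1}-N_{n-1}+1$. (vi) If $G$ is non-bipartite, $\frac{3-\sqrt5}{4}$ and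 $\frac{3+\sqrt5}{4}$ are eigenvalues of $\mathcal{L}_n$, each with multiplicity $E_{n-1}-N_{n-1}$. (These items together describe the whole spectrum of $\mathcal{L}_n$.)
   Context: Graphs are finite, simple and connected. The hexagonal graph $H(G)$ of $G$ is obtained by replacing each edge $uv$ of $G$ by two internally disjoint $u$–$v$ paths, one of length $1$ (the edge $uv$ itself) and one of length $5$ (with 4 new internal vertices). Set $H_0(G)=G$ and $H_n(G)=H(H_{n-1}(G))$ for $n\ge1$. With $N_n,E_n$ the numbers of vertices and edges of $H_n(G)$, $N_n=N_0+\frac45(6^n-1)E_0$ and $E_n=6^nE_0$. The normalized Laplacian of a graph with adjacency matrix $A$ and diagonal degree matrix $D$ is $\mathcal{L}=D^{-1/2}(D-A)D^{-1/2}=I-D^{-1/2}AD^{-1/2}$; the normalized Laplacian spectrum is the multiset of its eigenvalues. $m_{M}(\sigma)$ denotes the multiplicity of $\sigma$ as an eigenvalue of the matrix $M$; ''eigenvalue of multiplicity $0$'' means that the number is not an eigenvalue. *)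

(* Defs.v *)
From HB Require Import structures.
From mathcomp Require Import all_boot all_order all_algebra.

Set Implicit Arguments.
Unset Strict Implicit.
Unset Printing Implicit Defensive.

Import Order.TTheory GRing.Theory Num.Theory.
Local Open Scope ring_scope.

Record sgraph := SGraph {
  vertex :> finType;
  adj : rel vertex;
  adj_sym : symmetric adj;
  adj_irr : irreflexive adj
}.

Definition edges (G : sgraph) : {set {set G}} :=
  [set [set p.1; p.2] | p : G * G & adj p.1 p.2].

Definition graph_order (G : sgraph) : nat := #|G|.

Definition graph_size (G : sgraph) : nat := #|edges G|.

Definition degree (G : sgraph) (u : G) : nat := #|[set v : G | adj u v]|.

Definition is_connected (G : sgraph) : Prop :=
  forall u v : G, connect (@adj G) u v.

Definition bipartite (G : sgraph) : Prop :=
  exists c : G -> bool, forall u v : G, adj u v -> c u != c v.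

Section Hexagonal.

Variable G : sgraph.

Definition dart := {p : G * G | adj p.1 p.2}.

(* The four internal vertices of the path of length 5 replacing the edge uv are
   indexed by the two darts (u, v) and (v, u) carried by this edge, together
   with a boolean; the path is
     u -- ((u,v), false) -- ((u,v), true) -- ((v,u), true) -- ((v,u), false) -- v.
   This avoids choosing an orientation of the edge. *)
Definition hex_adj : rel (G + dart * bool) := fun x y =>
  match x, y with
  | inl u, inl v => adj u v
  | inl u, inr (d, b) | inr (d, b), inl u => ~~ b && ((val d).1 == u)
  | inr (d, b), inr (d', b') =>
      (d == d') && (b != b')
      || [&& b, b' & val d' == ((val d).2, (val d).1)]
  end.

Lemma hex_adj_sym : symmetric hex_adj.
Proof.
case=> [u|[d b]] [v|[d' b']] //=; first exact: adj_sym.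
rewrite (eq_sym d') (eq_sym b'); congr (_ || _).
rewrite andbCA; congr [&& _, _ & _].
case: d d' => [[u v] /= _] [[u' v'] /= _].
by rewrite !xpair_eqE andbC (eq_sym v') (eq_sym u').
Qed.

Lemma hex_adj_irr : irreflexive hex_adj.
Proof.
case=> [u|[[[u v] /= uv] b]] /=; first exact: adj_irr.
rewrite !eqxx /= xpair_eqE; case: (u =P v) uv => [->|_ _].
  by rewrite adj_irr.
by rewrite !andbF.
Qed.

Definition hexagonal : sgraph := SGraph hex_adj_sym hex_adj_irr.

End Hexagonal.

Definition hexagonal_iter (n : nat) (G : sgraph) : sgraph := iter n hexagonal G.

(* C plays the role of the field of complex numbers, so that spectra are taken
   over an algebraically closed field. *)
Section Spectrum.

Variable C : numClosedFieldType.

Section Laplacian.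

Variable G : sgraph.

Definition adjacency_mx : 'M[C]_#|G| :=
  \matrix_(i, j) (adj (enum_val i) (enum_val j))%:R.

Definition degree_mx : 'M[C]_#|G| :=
  diag_mx (\row_i (degree (enum_val i))%:R).

Definition degree_invsqrt_mx : 'M[C]_#|G| :=
  diag_mx (\row_i (sqrtC (degree (enum_val i))%:R)^-1).

Definition normalized_laplacian : 'M[C]_#|G| :=
  degree_invsqrt_mx *m (degree_mx - adjacency_mx) *m degree_invsqrt_mx.

End Laplacian.

Definition eig_mult (k : nat) (M : 'M[C]_k) (a : C) : nat := mup a (char_poly M).

Definition hex_cubic (s : C) : {poly C} :=
  4 *: 'X^3 - (10 + 2 * s) *: 'X^2 + (5 + 4 * s) *: 'X - s%:P.

End Spectrum.

(* Main.v *)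
Require Import Defs.
From HB Require Import structures.
From mathcomp Require Import all_boot all_order all_fingroup all_algebra.
From mathcomp Require Import ring zify.

Set Implicit Arguments.
Unset Strict Implicit.
Unset Printing Implicit Defensive.

Import Order.TTheory GRing.Theory Num.Theory.
Local Open Scope ring_scope.

(** With [c = 1 - lambda], the normalized Laplacian [L] of a graph with degree
    matrix [D] and adjacency matrix [A] satisfies
    [det (lambda - L) = (-1)^N * det (c D - A) / det D], so that everything
    reduces to determinants of the pencils [a D - b A], which need no square
    root.

    In [c D - A] for the hexagonal graph, the new vertices form disjoint paths
    on four vertices, one per edge of [G].  Write [x = 2 c] (all new vertices
    have degree 2).  The determinant of one path block is
    [V = x^4 - 3 x^2 + 1], and eliminating the new vertices by a Schur
    complement leaves a pencil of [G] itself ([idet_pencil_hexagonal]):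
    [det (c D_H - A_H) * V^N =
       V^E * (x^2 - 1)^N * det ((x^3 - 3 x) D - (x^2 - 2) A)].
    The Laplacian of [G] being real symmetric, it is diagonalizable, and the
    last determinant is, up to a constant, the product over its spectrum
    [s_1, ..., s_N] of the polynomials
    [(x^3 - 3 x) - (x^2 - 2) (1 - s_i)], and these are precisely
    [-2 * hex_cubic s_i] ([hex_cubic_pencil]).

    Comparing the multiplicities of a root [a] on both sides gives
    ([eig_mult_hexagonal])
    [N * mult a V + m_H a =
       E * mult a V + N * mult a (x^2 - 1) + #{i | hex_cubic s_i vanishes at a}].
    All items follow from this identity:
    - a number is a root of [hex_cubic s] for at most one [s]
      ([hex_cubic_root_inj]), and it is a simple root when [s] is real
      ([mup_hex_cubic]), so the last term is the multiplicity of [s] in [L];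
    - [x^2 - 1] vanishes exactly at 1/2 and 3/2, which are roots of the cubics
      of -1 and 3; the Dirichlet form confines the spectrum to [0, 2], hence
      these two values have multiplicity exactly [N];
    - [V * lambda * (lambda - 2) = hex_cubic 0 * hex_cubic 2]
      ([hex_cubic_mulX]), so that the roots of [V] are the four numbers
      involving sqrt 5, attached to the eigenvalues 0 and 2 of [G].  The
      eigenvalue 0 is simple because [G] is connected, and 2 is simple or
      absent according to whether [G] is bipartite.

    Finally, the hexagonal graph of [G] is connected like [G], and it is
    bipartite exactly when [G] is since all paths inserted have odd length;
    this lets the one-step result be applied to [H_(n-1)(G)]. *)

(** * Determinants indexed by finite types *)

Lemma big_enum_ord (R : Type) (idx : R) (op : Monoid.com_law idx) (T : finType)
    (F : T -> R) :
  \big[op/idx]_x F x = \big[op/idx]_(i < #|T|) F (enum_val i).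
Proof. by rewrite -(big_enum_val F). Qed.

Section IndexedDet.

Variable R : comNzRingType.

(** Vertices of the hexagonal graph live in a sum type, so that block
    decompositions are best expressed with indices in arbitrary finite types;
    the enumeration used is immaterial by [idet_reindex]. *)
Definition idet (T : finType) (F : T -> T -> R) : R :=
  \det (\matrix_(i, j < #|T|) F (enum_val i) (enum_val j)).

Lemma eq_idet (T : finType) (F F' : T -> T -> R) :
  F =2 F' -> idet F = idet F'.
Proof. by move=> eqF; congr (\det _); apply/matrixP=> i j; rewrite !mxE eqF. Qed.

Lemma det_enum_bij n (T : finType) (g : 'I_n -> T) (F : T -> T -> R) :
  bijective g -> \det (\matrix_(i, j) F (g i) (g j)) = idet F.
Proof.
move=> g_bij; have def_n : n = #|T| by rewrite -(bij_eq_card g_bij) card_ord.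
subst n; have s_inj : injective (enum_rank \o g).
  by move=> i j /enum_rank_inj /(bij_inj g_bij).
pose M := \matrix_(i, j < #|T|) F (enum_val i) (enum_val j).
have -> : \matrix_(i, j) F (g i) (g j) =
    row_perm (perm s_inj) (col_perm (perm s_inj) M).
  by apply/matrixP=> i j; rewrite !mxE !permE /= !enum_rankK.
rewrite row_permE col_permE !det_mulmx !det_perm mulrCA -signr_addb odd_permV.
by rewrite addbb mulr1.
Qed.

Lemma idet_reindex (S T : finType) (f : S -> T) (F : T -> T -> R) :
  bijective f -> idet (fun x y => F (f x) (f y)) = idet F.
Proof.
move=> f_bij; have g_bij := bij_comp f_bij (@enum_val_bij S).
exact: (det_enum_bij F g_bij).
Qed.

Lemma idet_diag (T : finType) (d : T -> R) :
  idet (fun x y => d x *+ (x == y)) = \prod_x d x.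
Proof.
rewrite /idet.
have -> : \matrix_(i, j) (d (enum_val i) *+ (enum_val i == enum_val j)) =
          diag_mx (\row_(i < #|T|) d (enum_val i)).
  by apply/matrixP=> i j; rewrite !mxE (inj_eq enum_val_inj).
rewrite det_diag [RHS](reindex _ (onW_bij _ (@enum_val_bij T))).
by apply: eq_bigr => i _; rewrite mxE.
Qed.

Lemma idet_scale (T : finType) a (F : T -> T -> R) :
  idet (fun x y => a * F x y) = a ^+ #|T| * idet F.
Proof. by rewrite -detZ; congr (\det _); apply/matrixP=> i j; rewrite !mxE. Qed.

(** Schur complement without division.  When [W] solves [F_TT W = v F_TS],
    multiplying [F] on the right by the lower triangular block matrix with
    blocks [v], [0], [- W], [1] kills the [TS] block.  Working over a
    commutative ring allows [F] to have polynomial entries. *)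
Lemma idet_schur (S T : finType) (F : S + T -> S + T -> R) (W : T -> S -> R) v :
    (forall t s, \sum_t' F (inr t) (inr t') * W t' s = v * F (inr t) (inl s)) ->
  idet F * v ^+ #|S| =
    idet (fun s s' => v * F (inl s) (inl s')
                      - \sum_t F (inl s) (inr t) * W t s')
    * idet (fun t t' => F (inr t) (inr t')).
Proof.
move=> FW.
pose g (i : 'I_(#|S| + #|T|)) : S + T :=
  match split i with inl j => inl (enum_val j) | inr j => inr (enum_val j) end.
pose g' (x : S + T) : 'I_(#|S| + #|T|) :=
  match x with
  | inl s => lshift _ (enum_rank s)
  | inr t => rshift _ (enum_rank t)
  end.
have gl i : g (lshift _ i) = inl (enum_val i) by rewrite /g (unsplitK (inl i)).
have gr i : g (rshift _ i) = inr (enum_val i) by rewrite /g (unsplitK (inr i)).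
have g_bij : bijective g.
  exists g'; last by case=> x; rewrite /= ?gl ?gr enum_rankK.
  by move=> i; case: (split_ordP i) => j ->; rewrite ?gl ?gr /= enum_valK.
rewrite -(det_enum_bij _ g_bij) /idet.
pose K := \matrix_(i, j) F (g i) (g j).
pose WM := \matrix_(i < #|T|, j < #|S|) W (enum_val i) (enum_val j).
have det_tri : \det (block_mx v%:M 0 (- WM) 1%:M) = v ^+ #|S|.
  by rewrite det_lblock det_scalar det1 mulr1.
rewrite -det_tri -/K -det_mulmx -[K]submxK mulmx_block.
have -> : dlsubmx K *m v%:M + drsubmx K *m - WM = 0.
  apply/matrixP=> i j; rewrite mulmxN mul_mx_scalar !mxE !gl !gr -FW.
  apply/eqP; rewrite subr_eq0; apply/eqP.
  rewrite big_enum_ord.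
  by apply: eq_bigr => k _; rewrite !mxE !gr.
rewrite !mulmx0 !mulmx1 !add0r det_ublock; congr (_ * _); congr (\det _).
  apply/matrixP=> i j; rewrite mulmxN mul_mx_scalar !mxE !gl; congr (_ - _).
  rewrite [RHS]big_enum_ord.
  by apply: eq_bigr => k _; rewrite !mxE !(gl, gr).
by apply/matrixP=> i j; rewrite !mxE !gr.
Qed.

End IndexedDet.

(** * Darts and orientations *)

Section Darts.

Variable G : sgraph.
Implicit Types (u v : G) (d : dart G).

Lemma dart_rev_proof d : adj (val d).2 (val d).1.
Proof. by rewrite adj_sym; apply: (valP d). Qed.

Definition rev_dart d : dart G :=
  exist _ ((val d).2, (val d).1) (dart_rev_proof d).

Lemma rev_dartK : involutive rev_dart.
Proof. by move=> d; apply: val_inj; case: d => [[u v]]. Qed.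

Lemma big_darts_at (R : Type) (idx : R) (op : Monoid.com_law idx) u
    (F : G -> R) :
  \big[op/idx]_(d : dart G | (val d).1 == u) F (val d).2 =
    \big[op/idx]_(v | adj u v) F v.
Proof.
pose h v : option {p : G * G | adj p.1 p.2} := insub (u, v).
rewrite [RHS](reindex_omap (fun d : dart G => (val d).2) h) => [|v uv]; last first.
  by rewrite /h insubT. 
apply: eq_bigl => d; rewrite /h; case: insubP => [d' uv def_d'|].
  rewrite [X in _ && X](_ : _ = (d' == d)) //= -(inj_eq val_inj) def_d'.
  by rewrite [LHS]eq_sym; move: uv => /= ->; case: d {def_d'} => [[u1 v1] ?];
    rewrite /= xpair_eqE eqxx andbT.
move=> /= /negbTE uv; rewrite uv; apply: contraFF uv => /eqP <-; exact: (valP d).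
Qed.

(** Darts follow the enumeration of the vertices in exactly one of their two
    directions, which provides an orientation of the edges. *)
Definition forward : pred (dart G) :=
  fun d => (enum_rank (val d).1 < enum_rank (val d).2)%N.

Definition arc := {d : dart G | forward d}.

Lemma forward_rev d : forward (rev_dart d) = ~~ forward d.
Proof.
rewrite /forward /= -leqNgt ltn_neqAle andb_idl // => _.
apply/negP=> /eqP/val_inj/enum_rank_inj def_u.
by have := valP d; rewrite /= def_u adj_irr.
Qed.

Lemma card_arc : #|{: arc}| = graph_size G.
Proof.
pose f (a : arc) : {set G} := [set (val (val a)).1; (val (val a)).2].
have f_inj : injective f.
  move=> a a' /setP eq_f; do 2!apply: val_inj.
  move: (valP a) (valP a') (valP (val a)) (valP (val a')) eq_f; rewrite /f /forward.
  case: (val (val a)) (val (val a')) => [u v] [u' v'] /= ltuv ltuv' uv uv' eq_f.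
  have neq (w w' : G) : adj w w' -> (w == w') = false.
    by move=> ww'; apply: contraTF ww' => /eqP->; rewrite adj_irr.
  have := eq_f v; have := eq_f u; rewrite !inE !eqxx orbT /= => /esym/orP[]/eqP eu.
    by rewrite -eu [v == u]eq_sym (neq _ _ uv) /= => /esym/eqP->.
  rewrite -eu [v == u]eq_sym (neq _ _ uv) orbF => /esym/eqP ev.
  by move: ltuv; rewrite eu ev ltnNge (ltnW ltuv').
rewrite /graph_size -(card_imset _ f_inj) /edges; apply: eq_card => A.
apply/imsetP/imsetP=> [[a _ ->]|[[u v]]].
  by exists (val (val a)); rewrite ?inE //; apply: (valP (val a)).
rewrite inE /= => uv ->.
pose d : dart G := exist _ (u, v) uv; have [fd|] := boolP (forward d).
  by exists (exist _ d fd).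
rewrite -forward_rev => fd; exists (exist _ (rev_dart d) fd) => //.
by rewrite /f /= setUC.
Qed.

End Darts.

(** * The determinant of the inserted paths *)

Lemma sum_delta (R : nzRingType) (T : finType) (a : T) (c : R) (g : T -> R) :
  \sum_z (c *+ (z == a)) * g z = c * g a.
Proof.
rewrite (bigD1 a) //= eqxx mulr1n big1 ?addr0 // => z /negbTE->.
by rewrite mulr0n mul0r.
Qed.

Section PathPencil.

Variables (R : idomainType) (G : sgraph) (x : R).

Definition path_mx (y z : dart G * bool) : R :=
  x *+ (y == z) - (@hex_adj G (inr y) (inr z))%:R.

Lemma path_mxE y z :
  path_mx y z =
    x *+ (z == y) - 1 *+ (z == (y.1, ~~ y.2))
    - y.2%:R *+ (z == (rev_dart y.1, true)).
Proof.
case: y z => [d b] [d' b']; rewrite /path_mx !xpair_eqE /= -addrA -opprD.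
have -> : (val d' == ((val d).2, (val d).1)) = (d' == rev_dart d) by [].
rewrite -mulrnA -natrD [d == _]eq_sym [b == _]eq_sym; congr (_ - _%:R).
by case: b b' => [] [] //=; rewrite ?andbT ?andbF ?addn0 ?orbF ?mul1n.
Qed.

Lemma sum_path_mx (g : dart G * bool -> R) y :
  \sum_z path_mx y z * g z =
    x * g y - g (y.1, ~~ y.2) - y.2%:R * g (rev_dart y.1, true).
Proof.
under eq_bigr => z _ do rewrite path_mxE !mulrBl.
by rewrite !sumrB !sum_delta mul1r.
Qed.

(** First the outer path vertices are eliminated, which leaves
    [(x^2 - 1) - x S] with [S] the reversal of darts; in terms of an
    orientation this is a 2 by 2 block matrix with scalar blocks, whose
    determinant is [((x^2 - 1)^2 - x^2)^E].  Each elimination multiplies both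
    sides by a power of its pivot, [x] and then [x^2 - 1], whence the two
    assumptions. *)
Lemma idet_path_mx :
    x != 0 -> x ^+ 2 - 1 != 0 ->
  idet path_mx = (x ^+ 4 - 3 * x ^+ 2 + 1) ^+ graph_size G.
Proof.
move=> x_neq0 x2_neq1.
pose f (s : dart G + dart G) :=
  match s with inl d => (d, true) | inr d => (d, false) end.
have f_bij : bijective f.
  exists (fun y : dart G * bool => if y.2 then inl y.1 else inr y.1); first by case.
  by case=> d [].
pose h (s : arc G + arc G) : dart G :=
  match s with inl a => val a | inr a => rev_dart (val a) end.
have h_bij : bijective h.
  have arcP (a : arc G) : forward (sval a) by apply: valP a.
  have h_inj : injective h.
    move=> [a|a] [b|b] /= eq_h; first by rewrite (val_inj eq_h).
    - by have := congr1 (@forward G) eq_h; rewrite forward_rev !arcP.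
    - by have := congr1 (@forward G) eq_h; rewrite forward_rev !arcP.
    by rewrite (val_inj (inv_inj (@rev_dartK G) eq_h)).
  have h_surj d : exists s, h s = d.
    have [fd|] := boolP (forward d); first by exists (inl (exist _ d fd)).
    rewrite -forward_rev => fd.
    by exists (inr (exist _ (rev_dart d) fd)); apply: rev_dartK.
  by have [g hg] := fin_all_exists h_surj; exists g => // s; apply: h_inj.
have x_ff d d' : path_mx (d, false) (d', false) = x *+ (d' == d).
  by rewrite path_mxE !xpair_eqE /= !(andbT, andbF) !mulr0n !subr0.
have x_ft d d' : path_mx (d, false) (d', true) = - (1 *+ (d' == d)).
  by rewrite path_mxE !xpair_eqE /= !(andbT, andbF) mul0rn sub0r subr0.
have x_tf d d' : path_mx (d, true) (d', false) = - (1 *+ (d' == d)).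
  by rewrite path_mxE !xpair_eqE /= !(andbT, andbF) mulr0n sub0r subr0.
have x_tt d d' :
    path_mx (d, true) (d', true) = x *+ (d' == d) - 1 *+ (d' == rev_dart d).
  by rewrite path_mxE !xpair_eqE /= !(andbT, andbF) mulr0n subr0.
pose inner (d d' : dart G) :=
  (x ^+ 2 - 1) *+ (d' == d) - x *+ (d' == rev_dart d).
have outer_elim : idet path_mx = idet inner.
  rewrite -(idet_reindex _ f_bij).
  apply: (mulIf (expf_neq0 #|{: dart G}| x_neq0)).
  rewrite (idet_schur (W := fun t s => - (1 *+ (t == s)))) => [|t s] /=; last first.
    under eq_bigr => t' _ do rewrite x_ff.
    by rewrite sum_delta x_ft !mulrN [s == t]eq_sym.
  congr (_ * _).
    apply: eq_idet => s s'; under eq_bigr => t _ do rewrite x_tf -mulNrn.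
    rewrite sum_delta x_tt /inner mulrBr mulrnBl !mulrnAr mulr1 -expr2.
    by rewrite mulN1r opprK [s == s']eq_sym addrAC.
  rewrite -prodr_const -idet_diag; apply: eq_idet => t t'.
  by rewrite x_ff eq_sym.
rewrite {}outer_elim -(idet_reindex _ h_bij) -card_arc.
apply: (mulIf (expf_neq0 #|{: arc G}| x2_neq1)).
have rev_arc (a b : arc G) : (val b == rev_dart (val a)) = false.
  by apply/eqP=> eq_h; have := valP b; rewrite eq_h forward_rev (valP a).
have i_ll (a b : arc G) : inner (val a) (val b) = (x ^+ 2 - 1) *+ (b == a).
  by rewrite /inner rev_arc subr0.
have i_lr (a b : arc G) : inner (val a) (rev_dart (val b)) = - (x *+ (b == a)).
  rewrite /inner [rev_dart _ == val a]eq_sym rev_arc.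
  by rewrite (inj_eq (inv_inj (@rev_dartK G))) sub0r.
have i_rl (a b : arc G) : inner (rev_dart (val a)) (val b) = - (x *+ (b == a)).
  by rewrite /inner rev_arc rev_dartK sub0r.
have i_rr (a b : arc G) :
    inner (rev_dart (val a)) (rev_dart (val b)) = (x ^+ 2 - 1) *+ (b == a).
  rewrite /inner rev_dartK (inj_eq (inv_inj (@rev_dartK G))).
  by rewrite [rev_dart _ == _]eq_sym rev_arc subr0.
rewrite (idet_schur (W := fun t s => - (x *+ (t == s)))) => [|t s] /=; last first.
  under eq_bigr => t' _ do rewrite i_rr.
  by rewrite sum_delta i_rl !mulrN [s == t]eq_sym.
rewrite -!prodr_const -!idet_diag; congr (_ * _); apply: eq_idet => s s'.
  under eq_bigr => t _ do rewrite i_lr -mulNrn.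
  rewrite sum_delta i_ll [s' == s]eq_sym.
  by case: (s == s'); rewrite ?mulr1n ?mulr0n; ring.
by rewrite i_rr eq_sym.
Qed.

End PathPencil.

(** * The pencil of the hexagonal graph *)

(** The entries of [a D - b A].  The equality test has its arguments in the
    order that suits [sum_delta]. *)
Definition pencil (R : comNzRingType) (G : sgraph) (a b : R) (u w : G) : R :=
  a * (degree u)%:R *+ (w == u) - b *+ adj u w.

Lemma degreeE (G : sgraph) (u : G) : degree u = (\sum_(v | adj u v) 1)%N.
Proof. by rewrite sum1dep_card. Qed.

Section HexagonalPencil.

Variable G : sgraph.

Lemma sum_dart_bool (V : nmodType) (g : dart G * bool -> V) :
  \sum_y g y = \sum_d (g (d, true) + g (d, false)).
Proof.
under [RHS]eq_bigr => d _ do rewrite -[_ + _](big_bool _ (fun b => g (d, b))).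
by rewrite pair_bigA; apply: eq_bigr => -[].
Qed.

Lemma degree_hexagonal_inl (u : G) :
  degree (inl u : hexagonal G) = (2 * degree u)%N.
Proof.
rewrite mul2n -addnn !degreeE big_sumType /=; congr (_ + _)%N.
rewrite big_mkcond [LHS]sum_dart_bool -(big_darts_at _ u (fun=> 1%N)).
rewrite [RHS]big_mkcond.
by apply: eq_bigr.
Qed.

Lemma degree_hexagonal_inr (y : dart G * bool) :
  degree (inr y : hexagonal G) = 2%N.
Proof.
case: y => d []; rewrite /degree.
  rewrite (_ : [set _ | _] =
      [set (inr (d, false) : hexagonal G); inr (rev_dart d, true)]).
    by rewrite cards2; case: eqP.
  apply/setP=> -[w|[d' b]]; rewrite !inE //= !(inj_eq inr_inj) !xpair_eqE.
  rewrite [d' == d]eq_sym.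
  have -> : (val d' == ((val d).2, (val d).1)) = (d' == rev_dart d) by [].
  by case: b; rewrite ?(andbT, andbF, orbF).
rewrite (_ : [set _ | _] = [set (inl (val d).1 : hexagonal G); inr (d, true)]).
  by rewrite cards2; case: eqP.
apply/setP=> -[w|[d' b]]; rewrite !inE /= ?orbF.
  by rewrite (inj_eq inl_inj) eq_sym.
by rewrite (inj_eq inr_inj) xpair_eqE eq_sym; case: b.
Qed.

(** Schur complement with respect to the inserted vertices.  For one path with
    ends [u] and [v], the system [F_TT W = V F_TS] is solved by
    [- (x^3 - 2 x), - (x^2 - 1), - x, - 1] (walking away from [u]) in the column
    of [u], and by the reversed list in the column of [v]; these are the
    determinants of shorter paths.  The factor [x^2 - 1] then comes out of both
    [x V - (x^3 - 2 x) = (x^2 - 1) (x^3 - 3 x)] and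
    [V + 1 = (x^2 - 1) (x^2 - 2)]. *)
Lemma idet_pencil_hexagonal (R : idomainType) (c : R) :
  let x := 2 * c in let V := x ^+ 4 - 3 * x ^+ 2 + 1 in
    x != 0 -> x ^+ 2 - 1 != 0 ->
  idet (@pencil R (hexagonal G) c 1) * V ^+ graph_order G =
    V ^+ graph_size G * (x ^+ 2 - 1) ^+ graph_order G
    * idet (@pencil R G (x ^+ 3 - 3 * x) (x ^+ 2 - 2)).
Proof.
move=> x V x_neq0 x2_neq1.
pose W (y : dart G * bool) (w : G) : R := if y.2
  then - ((x ^+ 2 - 1) *+ (w == (val y.1).1) + x *+ (w == (val y.1).2))
  else - ((x ^+ 3 - 2 * x) *+ (w == (val y.1).1) + 1 *+ (w == (val y.1).2)).
have K_ll u w : pencil c 1 (inl u : hexagonal G) (inl w) =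
    x * (degree u)%:R *+ (w == u) - 1 *+ adj u w.
  by rewrite /pencil degree_hexagonal_inl natrM mulrA [c * 2]mulrC.
have K_lr u y : pencil c 1 (inl u : hexagonal G) (inr y) =
    - (1 *+ (~~ y.2 && ((val y.1).1 == u))).
  by rewrite /pencil mulr0n sub0r; case: y.
have K_rl u y : pencil c 1 (inr y : hexagonal G) (inl u) =
    - (1 *+ (~~ y.2 && ((val y.1).1 == u))).
  by rewrite /pencil mulr0n sub0r; case: y.
have K_rr y z : pencil c 1 (inr y : hexagonal G) (inr z) = path_mx x y z.
  by rewrite /pencil degree_hexagonal_inr mulrC eq_sym.
rewrite (idet_schur (T := (dart G * bool)%type) (W := W)) => [|y w]; last first.
  under eq_bigr => z _ do rewrite K_rr.
  rewrite sum_path_mx K_rl /W; case: y => [d []] /=.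
    rewrite mulr0n oppr0 mulr0 mul1r.
    case: (w == _); case: (w == _); rewrite ?mulr1n ?mulr0n /V; ring.
  rewrite mul0r subr0 eq_sym.
  case: (_ == w); case: (w == _); rewrite ?mulr1n ?mulr0n /V; ring.
rewrite (eq_idet (F' := fun u w =>
    (x ^+ 2 - 1) * pencil (x ^+ 3 - 3 * x) (x ^+ 2 - 2) u w)).
  rewrite idet_scale (eq_idet K_rr) idet_path_mx //.
  by rewrite mulrC mulrA.
move=> u w; rewrite K_ll.
have -> : \sum_y pencil c 1 (inl u : hexagonal G) (inr y) * W y w =
   (x ^+ 3 - 2 * x) * (degree u)%:R *+ (w == u) + 1 *+ adj u w.
  rewrite sum_dart_bool.
  under eq_bigr => d _ do
    rewrite !K_lr /= mulr0n oppr0 mul0r add0r mulNr /W /= mulrN opprK.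
  transitivity (\sum_(d : dart G | (val d).1 == u)
      ((x ^+ 3 - 2 * x) *+ (w == u) + 1 *+ (w == (val d).2))).
    rewrite [RHS]big_mkcond; apply: eq_bigr => d _; case: eqP => [->|_].
      by rewrite mulr1n mul1r.
    by rewrite mulr0n mul0r.
  rewrite (big_darts_at _ u
    (fun v => (x ^+ 3 - 2 * x) *+ (w == u) + 1 *+ (w == v))).
  rewrite big_split /= sumr_const; congr (_ + _).
    rewrite mulr_natr mulrnAC /degree; congr (_ *+ _ *+ _).
    by apply: eq_card => v; rewrite inE.
  rewrite big_mkcond (bigD1 w) //= eqxx big1 ?addr0; first by case: adj.
  by move=> v /negbTE; rewrite eq_sym => ->; case: adj.
rewrite /pencil.
case: (w == u); case: (adj u w); rewrite ?mulr1n ?mulr0n /V; ring.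
Qed.

End HexagonalPencil.

(** * The spectrum of a normalized Laplacian *)

Section Spectrum.

Variables (C : numClosedFieldType) (G : sgraph).
Hypothesis degree_gt0 : forall u : G, (0 < degree u)%N.

Let L := normalized_laplacian C G.
Let t (u : G) : C := sqrtC (degree u)%:R.

Let t_gt0 u : 0 < t u.
Proof. by rewrite sqrtC_gt0 ltr0n. Qed.

Let t_neq0 u : t u != 0.
Proof. by rewrite gt_eqF. Qed.

Let t_sqr u : t u * t u = (degree u)%:R.
Proof. by rewrite -expr2 sqrtCK. Qed.

Lemma normalized_laplacianE i j :
  L i j = (i == j)%:R
          - (adj (enum_val i) (enum_val j))%:R / (t (enum_val i) * t (enum_val j)).
Proof.
rewrite /L /normalized_laplacian /degree_invsqrt_mx mul_mx_diag mxE mul_diag_mx !mxE.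
rewrite -/(t (enum_val i)) -/(t (enum_val j)); case: (eqVneq i j) => [<-|_].
  by rewrite !mulr1n -t_sqr; field; apply: t_neq0.
by rewrite !mulr0n; field; rewrite !t_neq0.
Qed.

Lemma normalized_laplacian_hermitian : L \is hermsymmx.
Proof.
apply: realsym_hermsym.
  apply/is_hermitianmxP; rewrite expr0 scale1r map_mx_id //; apply/matrixP=> i j.
  by rewrite [RHS]mxE !normalized_laplacianE eq_sym adj_sym [t _ * _]mulrC.
apply/mxOverP=> i j; rewrite normalized_laplacianE.
by rewrite rpredB ?rpred_div ?rpredM ?realn ?gtr0_real.
Qed.

Let spec := spectral_diag L.
Let P := spectralmx L.

Lemma normalized_laplacian_spectral : L = invmx P *m diag_mx spec *m P.
Proof.
by apply/orthomx_spectralP; apply/hermitian_normalmx/normalized_laplacian_hermitian.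
Qed.

(** Valid for all polynomials [p] and [q] because [L] is diagonalized by a
    constant matrix. *)
Lemma det_affine_laplacian (p q : {poly C}) :
  \det (p%:M + q *: map_mx polyC L) = \prod_i (p + q * (spec 0 i)%:P).
Proof.
have P_unit : P \in unitmx := spectral_unit L.
have PP : map_mx polyC (invmx P) *m map_mx polyC P = 1%:M.
  by rewrite -map_mxM mulVmx // map_mx1.
have -> : p%:M + q *: map_mx polyC L =
    map_mx polyC (invmx P) *m diag_mx (\row_i (p + q * (spec 0 i)%:P))
    *m map_mx polyC P.
  have -> : diag_mx (\row_i (p + q * (spec 0 i)%:P)) =
      p%:M + q *: map_mx polyC (diag_mx spec).
    apply/matrixP=> i j; rewrite !mxE.
    case: eqP => _; rewrite ?mulr1n ?mulr0n //.
    by rewrite rmorph0 mulr0 addr0.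
  rewrite mulmxDr mulmxDl mul_mx_scalar -scalemxAl PP scalemx1; congr (_ + _).
  by rewrite -scalemxAr -scalemxAl {1}normalized_laplacian_spectral !map_mxM.
rewrite !det_mulmx mulrAC -det_mulmx PP det1 mul1r det_diag.
by apply: eq_bigr => i _; rewrite mxE.
Qed.

Lemma char_poly_laplacian : char_poly L = \prod_i ('X - (spec 0 i)%:P).
Proof.
rewrite /char_poly /char_poly_mx -scaleN1r det_affine_laplacian.
by apply: eq_bigr => i _; rewrite mulN1r.
Qed.

(** Multiplying [(a - b) + b L] on both sides by the diagonal matrix of the
    square roots of the degrees gives back [a D - b A]. *)
Lemma idet_pencil_spectral (a b : {poly C}) :
  idet (@pencil {poly C} G a b) =
    (\prod_(u : G) (degree u)%:R)%:P * \prod_i ((a - b) + b * (spec 0 i)%:P).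
Proof.
rewrite -det_affine_laplacian.
pose T := diag_mx (\row_(i < #|G|) (t (enum_val i))%:P).
have det_T : \det T * \det T = (\prod_(u : G) (degree u)%:R)%:P.
  rewrite det_diag -big_split (big_enum_ord _ (fun u : G => (degree u)%:R : C)) rmorph_prod.
  by apply: eq_bigr => i _; rewrite /= !mxE -t_sqr rmorphM.
rewrite -det_T -mulrA [X in _ * X]mulrC mulrA -!det_mulmx /idet; congr (\det _).
apply/matrixP=> i j.
have : map_mx polyC L i j = (i == j)%:R
    - (adj (enum_val i) (enum_val j))%:R
      * ((t (enum_val i))^-1)%:P * ((t (enum_val j))^-1)%:P.
  rewrite mxE normalized_laplacianE invfM rmorphB /= mulrA !rmorphM /=.
  by congr (_ - _ * _ * _); rewrite rmorph_nat.
have tV u : (t u)%:P * ((t u)^-1)%:P = 1 by rewrite -polyCM mulfV.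
have tt u : (t u)%:P * (t u)%:P = (degree u)%:R by rewrite -polyCM t_sqr rmorph_nat.
move: (map_mx polyC L) => LP LP_ij.
rewrite mul_mx_diag mxE mul_diag_mx !mxE LP_ij.
rewrite /pencil (inj_eq enum_val_inj) [j == i]eq_sym -tt.
set ti := (t (enum_val i))%:P; set tj := (t (enum_val j))%:P.
set A := (adj _ _)%:R.
transitivity (a * (ti * tj) * (i == j)%:R
              - b * A * (ti * (t (enum_val i))^-1%:P)
                    * (tj * (t (enum_val j))^-1%:P)).
  rewrite !tV !mulr1 !mulr_natr; congr (_ - _).
  by rewrite /ti /tj; case: (eqVneq i j) => [->|_].
by rewrite -[(a - b) *+ _]mulr_natr; ring.
Qed.

(** Eigenvectors of [L] are, after scaling by the square roots of the degrees,
    the eigenfunctions of the random walk matrix [D^-1 A] for [1 - s]; they are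
    stated here with the denominators cleared. *)
Definition walk_eigenfun (s : C) (g : G -> C) : Prop :=
  forall u, \sum_(w | adj u w) g w = (1 - s) * (degree u)%:R * g u.

Let vec (g : G -> C) : 'rV[C]_#|G| := \row_i (t (enum_val i) * g (enum_val i)).

Lemma walk_eigenfunE s g : walk_eigenfun s g <-> vec g *m L = s *: vec g.
Proof.
have mulL (u : G) :
    (vec g *m L) 0 (enum_rank u) = t u * g u - (\sum_(w | adj u w) g w) / t u.
  have -> : (vec g *m L) 0 (enum_rank u) =
      \sum_(w : G) (t w * g w * (1 *+ (w == u)) - g w / t u *+ adj u w).
    rewrite mxE [RHS]big_enum_ord; apply: eq_bigr => i _.
    rewrite normalized_laplacianE mxE enum_rankK (can2_eq enum_valK enum_rankK).
    rewrite mulrBr -[g _ / _ *+ _]mulr_natr [adj u _]adj_sym; congr (_ - _).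
    by field; rewrite !t_neq0.
  rewrite sumrB; congr (_ - _); last first.
    by rewrite mulr_suml [RHS]big_mkcond; apply: eq_bigr => w _; case: adj.
  under eq_bigr => w _ do rewrite mulrC.
  by rewrite sum_delta mul1r.
split=> [eig|eig u].
  apply/rowP=> i; rewrite -[i]enum_valK mulL eig !mxE enum_rankK -t_sqr.
  by field; rewrite t_neq0.
have := congr1 (fun v : 'rV_#|G| => v 0 (enum_rank u)) eig.
rewrite mulL !mxE enum_rankK -t_sqr => eq_u.
have -> : \sum_(w | adj u w) g w =
    t u * (t u * g u - (t u * g u - (\sum_(w | adj u w) g w) / t u)).
  by field; rewrite t_neq0.
by rewrite eq_u; ring.
Qed.

Lemma vec_surj v : exists g, v = vec g.
Proof.
exists (fun u => v 0 (enum_rank u) / t u); apply/rowP=> i.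
by rewrite mxE enum_valK mulrCA mulfV ?mulr1.
Qed.

Lemma vec_eq0 g : vec g = 0 <-> forall u, g u = 0.
Proof.
split=> [/rowP g0 u|g0]; last by apply/rowP=> i; rewrite !mxE g0 mulr0.
have /eqP := g0 (enum_rank u); rewrite !mxE enum_rankK mulf_eq0 (negbTE (t_neq0 u)).
by move/eqP.
Qed.

Lemma eigenvalue_walk s :
  eigenvalue L s <-> exists g, walk_eigenfun s g /\ exists u, g u != 0.
Proof.
split=> [/eigenvalueP[v vL v_neq0]|[g [/walk_eigenfunE gL [u gu]]]].
  have [g def_v] := vec_surj v; exists g; split.
    by apply/walk_eigenfunE; rewrite -def_v.
  apply/existsP; apply: contraNT v_neq0 => /existsPn g0; rewrite def_v; apply/eqP.
  by apply/vec_eq0 => u; apply/eqP; have := g0 u; rewrite negbK.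
apply/eigenvalueP; exists (vec g) => //; apply/eqP=> /vec_eq0/(_ u)/eqP.
exact/negP.
Qed.

Lemma eig_mult_spectral s : eig_mult L s = (\sum_i (spec 0%R i == s))%N.
Proof.
rewrite /eig_mult char_poly_laplacian -(big_map (spec 0) xpredT (fun y => 'X - y%:P)).
rewrite mu_prod_XsubC -sum1_count big_map big_mkcond.
by apply: eq_bigr => i _ /=; case: eqP.
Qed.

Lemma eigenvalue_spectral s : eigenvalue L s <-> exists i, spec 0 i = s.
Proof.
rewrite eigenvalue_root_char char_poly_laplacian rootE horner_prod.
split=> [/prodf_eq0[i _]|[i def_s]]; last apply/prodf_eq0.
  by rewrite !hornerE subr_eq0 => /eqP->; exists i.
by exists i; rewrite // !hornerE def_s subrr.
Qed.

(** Two indices with the same eigenvalue would give two proportional rows of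
    the invertible matrix of eigenvectors. *)
Lemma eig_mult_simple s g0 :
    walk_eigenfun s g0 -> (exists u, g0 u != 0) ->
    (forall g, walk_eigenfun s g -> exists a, forall u, g u = a * g0 u) ->
  eig_mult L s = 1%N.
Proof.
move=> eig0 g0_neq0 eig_g0.
have /eigenvalue_spectral[i spec_i] : eigenvalue L s.
  by apply/eigenvalue_walk; exists g0.
rewrite eig_mult_spectral (bigD1 i) //= spec_i eqxx big1 // => j ij.
apply/eqP; rewrite eqb0; apply/eqP=> spec_j.
have P_unit : P \in unitmx := spectral_unit L.
have row_mult k : spec 0 k = s -> exists a, delta_mx 0 k *m P = a *: vec g0.
  move=> spec_k; have [g def_g] := vec_surj (delta_mx 0 k *m P).
  have [a def_a] : exists a, forall u, g u = a * g0 u.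
    apply/eig_g0/walk_eigenfunE; rewrite -def_g {1}normalized_laplacian_spectral.
    rewrite -!mulmxA mulKVmx // mulmxA scalemxAl; congr (_ *m _).
    apply/rowP=> l; rewrite mul_mx_diag !mxE eqxx /=.
    by case: (l =P k) => [->|_]; rewrite ?mul0r ?mulr0 // spec_k mulrC.
  exists a; rewrite def_g; apply/rowP=> l; rewrite !mxE def_a; ring.
have [[a def_a] [b def_b]] := (row_mult i spec_i, row_mult j spec_j).
have : (b *: delta_mx 0 i - a *: delta_mx 0 j : 'rV_#|G|) *m P = 0.
  by rewrite mulmxBl -!scalemxAl def_a def_b !scalerA mulrC subrr.
move/(congr1 (mulmx^~ (invmx P))); rewrite mulmxK // mul0mx => /rowP eq0.
have a0 : a = 0.
  have := eq0 j; rewrite !mxE !eqxx (negbTE ij) /= mulr0 mulr1 sub0r.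
  by move/eqP; rewrite oppr_eq0 => /eqP.
move: def_a; rewrite a0 scale0r => /(congr1 (mulmx^~ (invmx P))).
rewrite mulmxK // mul0mx => /rowP/(_ i)/eqP.
by rewrite !mxE !eqxx oner_eq0.
Qed.

(** The Dirichlet form ([eps = 1]) and its signless variant ([eps = -1]) at an
    eigenfunction.  Their nonnegativity bounds [s] from both sides, and their
    vanishing at [s = 0] and [s = 2] describes the extremal eigenfunctions. *)
Lemma dirichlet_form s (eps : C) g :
    eps ^+ 2 = 1 -> eps \is Num.real -> walk_eigenfun s g ->
  \sum_u \sum_(w | adj u w) `|g u - eps * g w| ^+ 2 =
    2 * (1 - eps * (1 - s)) * \sum_u (degree u)%:R * `|g u| ^+ 2.
Proof.
move=> eps2 eps_real eig.
pose S := \sum_u (degree u)%:R * `|g u| ^+ 2.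
have S_l : \sum_u \sum_(w | adj u w) `|g u| ^+ 2 = S.
  apply: eq_bigr => u _; rewrite sumr_const mulr_natl; congr (_ *+ _).
  by apply: eq_card => w; rewrite inE.
have swap (F : G -> G -> C) :
    \sum_u \sum_(w | adj u w) F w u = \sum_u \sum_(w | adj u w) F u w.
  rewrite (exchange_big_dep predT) //=; apply: eq_bigr => u _.
  by apply: eq_bigl => w; rewrite adj_sym.
have cross : \sum_u \sum_(w | adj u w) (g u)^* * g w = (1 - s) * S.
  rewrite mulr_sumr; apply: eq_bigr => u _; rewrite -mulr_sumr eig normCK; ring.
transitivity (\sum_u \sum_(w | adj u w) (`|g u| ^+ 2 + `|g w| ^+ 2
    - eps * ((g w)^* * g u) - eps * ((g u)^* * g w))).
  apply: eq_bigr => u _; apply: eq_bigr => w _.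
  rewrite !normCK rmorphB rmorphM /= (CrealP eps_real) -[g w * (g w)^*]mul1r -eps2.
  ring.
under eq_bigr => u _ do rewrite !sumrB big_split /=.
rewrite !sumrB big_split /= (swap (fun w u => `|g w| ^+ 2)) S_l.
under eq_bigr => u _ do rewrite -mulr_sumr.
under [X in _ - X]eq_bigr => u _ do rewrite -mulr_sumr.
rewrite -!mulr_sumr (swap (fun w u => (g w)^* * g u)) cross -/S.
ring.
Qed.

Lemma eigenvalue_laplacian_bounds s : eigenvalue L s -> 0 <= s <= 2.
Proof.
move=> /eigenvalue_walk[g [eig [u gu]]].
have S_gt0 : 0 < \sum_u (degree u)%:R * `|g u| ^+ 2.
  rewrite (bigD1 u) //= ltr_pwDl ?sumr_ge0 // => [|w _].
    by rewrite mulr_gt0 ?ltr0n // exprn_gt0 // normr_gt0.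
  by rewrite mulr_ge0 // exprn_ge0.
have form_ge0 (eps : C) :
    0 <= \sum_u \sum_(w | adj u w) `|g u - eps * g w| ^+ 2.
  by do 2!apply: sumr_ge0 => ? _; apply: exprn_ge0.
apply/andP; split.
  have := form_ge0 1; rewrite (dirichlet_form _ _ eig) ?expr1n ?rpred1 //.
  rewrite pmulr_lge0 //.
  by rewrite mul1r opprB addrC subrK pmulr_rge0.
have := form_ge0 (-1).
rewrite (dirichlet_form _ _ eig) ?sqrrN ?expr1n ?rpredN ?rpred1 //.
by rewrite pmulr_lge0 // pmulr_rge0 // mulN1r opprK addrA -[1 + 1]/2 subr_ge0.
Qed.

Lemma walk_eigenfun_edge (eps : C) g :
    eps ^+ 2 = 1 -> eps \is Num.real -> walk_eigenfun (1 - eps) g ->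
  forall u w, adj u w -> g u = eps * g w.
Proof.
move=> eps2 eps_real eig u w uw; apply/eqP; rewrite -subr_eq0 -normr_eq0 -sqrf_eq0.
have /eqP := dirichlet_form eps2 eps_real eig.
rewrite subKr -expr2 eps2 subrr mulr0 mul0r.
rewrite psumr_eq0 => [/allP/(_ u)|v _]; last first.
  by apply: sumr_ge0 => ? _; apply: exprn_ge0.
rewrite mem_index_enum => /(_ isT).
rewrite psumr_eq0 => [/allP/(_ w)|v _]; last first.
  exact: exprn_ge0.
by rewrite mem_index_enum uw => /(_ isT).
Qed.

Lemma edge_walk_eigenfun (eps : C) g :
    eps ^+ 2 = 1 -> (forall u w, adj u w -> g u = eps * g w) ->
  walk_eigenfun (1 - eps) g.
Proof.
move=> eps2 g_edge u; rewrite (eq_bigr (fun=> eps * g u)) => [|w uw]; last first.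
  by rewrite (g_edge u w uw) mulrA -expr2 eps2 mul1r.
rewrite sumr_const subKr -mulrA mulr_natl mulrnAr; congr (_ *+ _).
by apply: eq_card => w; rewrite inE.
Qed.

Section Connected.

Hypothesis G_connected : is_connected G.

Lemma connected_propagate (Q : G -> Prop) u :
  Q u -> (forall v w, adj v w -> Q v -> Q w) -> forall w, Q w.
Proof.
move=> Qu Q_adj w; have /connectP[p] := G_connected u w.
elim: p u Qu => [|v p IHp] u Qu /=; first by move=> _ ->.
by case/andP=> uv; apply: IHp; apply: Q_adj Qu.
Qed.

Lemma eig_mult_laplacian0 (u : G) : eig_mult L 0 = 1%N.
Proof.
rewrite -(subrr 1); apply: (@eig_mult_simple _ (fun=> 1)).
- by apply: edge_walk_eigenfun => *; rewrite ?expr1n ?mulr1.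
- by exists u; apply: oner_neq0.
move=> g /walk_eigenfun_edge g_edge; exists (g u) => w; rewrite mulr1.
apply: (@connected_propagate (fun w => g w = g u) u) => // v v' vv' <-.
by rewrite (g_edge _ _ v v' vv') ?mul1r ?expr1n ?rpred1.
Qed.

Lemma walk_eigenfun2_edge g :
  walk_eigenfun 2 g -> forall u w, adj u w -> g u = - g w.
Proof.
rewrite -[2]/(1 + 1 : C) -{2}[1]opprK => eig u w uw.
rewrite -mulN1r; apply: walk_eigenfun_edge eig _ _ uw.
  by rewrite sqrrN expr1n.
by rewrite rpredN rpred1.
Qed.

Lemma eig_mult_laplacian2 (u : G) : bipartite G -> eig_mult L 2 = 1%N.
Proof.
case=> c c_edge; have c_sign v w : adj v w -> (-1) ^+ c v = - (-1) ^+ c w :> C.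
  by move/c_edge; case: (c v) (c w) => [] []; rewrite // ?expr1 ?expr0 ?opprK.
apply: (@eig_mult_simple _ (fun v => (-1) ^+ c v)).
- rewrite -[2]/(1 + 1 : C) -{2}[1]opprK; apply: edge_walk_eigenfun => [|v w vw].
    by rewrite sqrrN expr1n.
  by rewrite mulN1r; apply: c_sign.
- by exists u; rewrite signr_eq0.
move=> g /walk_eigenfun2_edge g_edge; exists (g u * (-1) ^+ c u).
apply: (@connected_propagate _ u) => [|v w vw].
  by rewrite -mulrA -expr2 sqrr_sign mulr1.
by rewrite (g_edge _ _ vw) (c_sign _ _ vw) mulrN => /oppr_inj.
Qed.

(** An eigenfunction for 2 changes sign along every edge, so that its values
    are a fixed nonzero number and its opposite; these are the two colours. *)
Lemma eigenvalue2_bipartite : eigenvalue L 2 -> bipartite G.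
Proof.
case/eigenvalue_walk=> g [/walk_eigenfun2_edge g_edge [u gu]].
have g_neq0 : forall v, g v != 0.
  apply: (@connected_propagate _ u) => // v w vw.
  by rewrite (g_edge _ _ vw) oppr_eq0.
have g_pm : forall v, g v = g u \/ g v = - g u.
  apply: (@connected_propagate _ u) => [|v w vw]; first by left.
  by rewrite (g_edge _ _ vw) => -[<-|/oppr_inj ->]; [right; rewrite opprK | left].
exists (fun v => g v == g u) => v w vw; apply/negP=> /eqP eq_c.
by case: (g_pm w) eq_c => gw;
  rewrite (g_edge _ _ vw) gw ?opprK eqxx eqNr (negbTE gu).
Qed.

End Connected.

End Spectrum.

(** * Multiplicities of roots *)

Section RootMultiplicity.

Variable F : fieldType.

Lemma mup_exp (a : F) p n : p != 0 -> mup a (p ^+ n) = (n * mup a p)%N.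
Proof.
move=> p_neq0; elim: n => [|n IHn]; first by rewrite expr0 mupNroot ?root1.
by rewrite exprS mupM ?expf_neq0 // IHn mulSn.
Qed.

Lemma mup_prod (I : finType) (a : F) (p : I -> {poly F}) :
  (forall i, p i != 0) -> mup a (\prod_i p i) = (\sum_i mup a (p i))%N.
Proof.
move=> p_neq0.
suff [] : \prod_i p i != 0 /\
    mup a (\prod_i p i) = (\sum_i mup a (p i))%N by [].
elim/big_rec2: _ => [|i m q _ [q_neq0 IHq]].
  by rewrite oner_neq0 mupNroot ?root1.
by rewrite mulf_neq0 // mupM // IHq.
Qed.

Lemma mup_gt0 (a : F) p : p != 0 -> (0 < mup a p)%N = root p a.
Proof. by move=> p_neq0; rewrite -dvdp_XsubCl XsubC_dvd. Qed.

Lemma mup_simple (a : F) p : root p a -> ~~ root p^`() a -> mup a p = 1%N.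
Proof.
move=> pa p'a; have p_neq0 : p != 0.
  by apply: contraNneq p'a => ->; rewrite deriv0 root0.
apply/eqP; rewrite eqn_leq mup_gt0 // pa andbT mup_leq //.
apply: contra p'a => /dvdpP[q ->].
rewrite rootE derivM deriv_exp derivXsubC !hornerE /= subrr expr1 add0r.
by rewrite subrr !mulr0 addr0.
Qed.

End RootMultiplicity.

Lemma eigenvalue_eig_mult (C : numClosedFieldType) k (M : 'M[C]_k) a :
  eigenvalue M a = (0 < eig_mult M a)%N.
Proof.
rewrite eigenvalue_root_char /eig_mult mup_gt0 //.
by rewrite monic_neq0 ?char_poly_monic.
Qed.

(** * The hexagonal cubics *)

Section HexCubic.

Variable C : numClosedFieldType.
Implicit Types a s : C.

Lemma horner_hex_cubic s a :
  (hex_cubic s).[a] = 4 * a ^+ 3 - (10 + 2 * s) * a ^+ 2 + (5 + 4 * s) * a - s.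
Proof. by rewrite /hex_cubic !hornerE /=. Qed.

(** The cubic is affine in [s]; its coefficient of [s] is, up to sign,
    [2 a^2 - 4 a + 1], which has no common root with the remaining part. *)
Lemma hex_cubic_root_inj s s' a :
  root (hex_cubic s) a -> root (hex_cubic s') a -> s = s'.
Proof.
rewrite !rootE !horner_hex_cubic => /eqP sa /eqP s'a; apply/eqP; rewrite -subr_eq0.
have : (s - s') * (2 * a ^+ 2 - 4 * a + 1) = 0.
  by rewrite -[RHS](subrr 0) -{1}s'a -sa; ring.
move/eqP; rewrite mulf_eq0 => /orP[//|/eqP a_root].
suff : (-1 : C) = 0 by move/eqP; rewrite oppr_eq0 oner_eq0.
have a1 : a = 1.
  apply/eqP; rewrite -subr_eq0; apply/eqP.
  transitivity ((2 * a - 1 - s) * (2 * a ^+ 2 - 4 * a + 1)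
    - (4 * a ^+ 3 - (10 + 2 * s) * a ^+ 2 + (5 + 4 * s) * a - s)); first by ring.
  by rewrite a_root sa mulr0 subrr.
by rewrite -a_root a1; ring.
Qed.

Lemma root_hex_cubic_eq s s' a :
  root (hex_cubic s) a -> root (hex_cubic s') a = (s == s').
Proof. by move=> sa; apply/idP/eqP=> [/(hex_cubic_root_inj sa)|<-]. Qed.

Lemma polyseq_hex_cubic s :
  hex_cubic s = [:: - s; 5 + 4 * s; - (10 + 2 * s); 4] :> seq C.
Proof.
have -> : hex_cubic s = Poly [:: - s; 5 + 4 * s; - (10 + 2 * s); 4].
  rewrite /= !cons_poly_def /hex_cubic -!mul_polyC.
  rewrite !(rmorphD, rmorphM, rmorphN, rmorph0, rmorph_nat) /=; ring.
by rewrite (@PolyK _ 0) //= pnatr_eq0.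
Qed.

Lemma hex_cubic_neq0 s : hex_cubic s != 0.
Proof. by rewrite -size_poly_eq0 polyseq_hex_cubic. Qed.

Lemma hex_cubic_split s :
  exists l1 l2 l3 : C,
    hex_cubic s = 4 *: (('X - l1%:P) * ('X - l2%:P) * ('X - l3%:P)).
Proof.
have [r def_p] := closed_field_poly_normal (hex_cubic s).
have size_r : size r = 3.
  have := congr1 (fun p : {poly C} => size p) def_p.
  rewrite {1}polyseq_hex_cubic size_scale ?lead_coef_eq0 ?hex_cubic_neq0 //.
  by rewrite size_prod_XsubC => -[].
rewrite def_p lead_coefE polyseq_hex_cubic /=.
case: r size_r {def_p} => [|l1 [|l2 [|l3 [|]]]] // _; exists l1, l2, l3.
by rewrite !big_cons big_nil mulr1 mulrA.
Qed.

(** In terms of [c = 1 - a] and [m = 1 - s] the discriminant of the cubic is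
    [32 m^4 + 36 m^2 + 432], which is positive when [m] is real. *)
Lemma mup_hex_cubic s a :
  s \is Num.real -> mup a (hex_cubic s) = root (hex_cubic s) a.
Proof.
move=> s_real; have [pa|] := boolP (root (hex_cubic s) a); last exact: mupNroot.
apply: (mup_simple pa); apply/negP=> p'a.
move: pa; rewrite rootE horner_hex_cubic => /eqP pa.
have {}p'a : 12 * a ^+ 2 - 2 * (10 + 2 * s) * a + (5 + 4 * s) = 0.
  move: p'a; rewrite rootE /hex_cubic.
  rewrite !(derivD, derivB, derivN, derivZ, derivXn, derivX, derivC) /=.
  by rewrite !hornerE /= => /eqP <-; ring.
pose c := 1 - a; pose m := 1 - s; pose A := 36 + 4 * m ^+ 2; pose B := 15 * m.
pose p := 4 * c ^+ 3 - 2 * m * c ^+ 2 - 3 * c + m.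
pose p' := 12 * c ^+ 2 - 4 * m * c - 3.
have p_0 : p = 0.
  by apply/eqP; rewrite -oppr_eq0 -pa; apply/eqP; rewrite /p /c /m; ring.
have p'_0 : p' = 0 by rewrite -p'a /p' /c /m; ring.
(* The remainder of the division of [18 p] by its derivative [p'] is
   [B - A * c]: a double root would be [B / A]. *)
have Ac : A * c - B = p' * (6 * c - m) - 18 * p by rewrite /A /B /p /p'; ring.
have disc : 9 * (432 + 36 * m ^+ 2 + 32 * m ^+ 4) =
    (A * c - B) * (12 * (A * c + B) - 4 * m * A) - A ^+ 2 * p'.
  by rewrite /A /B /p'; ring.
have disc0 : 9 * (432 + 36 * m ^+ 2 + 32 * m ^+ 4) = 0.
  by rewrite disc Ac p_0 p'_0 !(mul0r, mulr0, subrr).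
have m_real : m \is Num.real by rewrite rpredB ?rpred1.
have : 0 < 9 * (432 + 36 * m ^+ 2 + 32 * m ^+ 4).
  have m_ge0 k : 0 <= m ^+ (2 * k).
    by rewrite real_exprn_even_ge0 // oddM.
  have := m_ge0 1%N; have := m_ge0 2%N; rewrite !muln1 => m4 m2.
  rewrite mulr_gt0 ?ltr0n //.
  apply: ltr_wpDr; first exact: mulr_ge0 (ler0n _ _) m4.
  by apply: ltr_wpDr; [exact: mulr_ge0 (ler0n _ _) m2 | rewrite ltr0n].
by rewrite disc0 ltxx.
Qed.

Lemma hex_cubic_pencil s (x := 2 * (1 - 'X) : {poly C}) :
  (x ^+ 3 - 3 * x) - (x ^+ 2 - 2) + (x ^+ 2 - 2) * s%:P = - 2 * hex_cubic s.
Proof.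
rewrite /x /hex_cubic -!mul_polyC.
rewrite !(rmorphD, rmorphM, rmorphN, rmorph0, rmorph_nat) /=; ring.
Qed.

Lemma root_hex_cubic_half : root (hex_cubic (-1 : C)) (1 / 2).
Proof.
by rewrite rootE horner_hex_cubic; apply/eqP; field; rewrite ?pnatr_eq0.
Qed.

Lemma root_hex_cubic_three_half : root (hex_cubic (3 : C)) (3 / 2).
Proof.
by rewrite rootE horner_hex_cubic; apply/eqP; field; rewrite ?pnatr_eq0.
Qed.

Lemma root_hex_cubic_0 : root (hex_cubic (0 : C)) 0.
Proof. by rewrite rootE horner_hex_cubic; apply/eqP; ring. Qed.

Lemma root_hex_cubic_2 : root (hex_cubic (2 : C)) 2.
Proof. by rewrite rootE horner_hex_cubic; apply/eqP; ring. Qed.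

Lemma root_hex_cubic_sqrt5_0 (e : C) :
  e ^+ 2 = 5 -> root (hex_cubic 0) ((5 + e) / 4).
Proof.
move=> e2; rewrite rootE horner_hex_cubic; apply/eqP.
transitivity ((5 + e) * (e ^+ 2 - 5) / 16); last by rewrite e2 subrr mulr0 mul0r.
by field; rewrite ?pnatr_eq0.
Qed.

Lemma root_hex_cubic_sqrt5_2 (e : C) :
  e ^+ 2 = 5 -> root (hex_cubic 2) ((3 + e) / 4).
Proof.
move=> e2; rewrite rootE horner_hex_cubic; apply/eqP.
transitivity ((e - 5) * (e ^+ 2 - 5) / 16); last by rewrite e2 subrr mulr0 mul0r.
by field; rewrite ?pnatr_eq0.
Qed.

Let sqr5_neq : (5 : C) ^+ 2 <> 5.
Proof. by move/eqP; rewrite -natrX eqr_nat. Qed.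

Lemma sqrt5_0_neq0 (e : C) : e ^+ 2 = 5 -> (5 + e) / 4 != 0.
Proof.
move=> e5; apply/eqP=> a0; apply: sqr5_neq.
rewrite -sqrrN -[RHS]e5; congr (_ ^+ 2).
have -> : e = 4 * ((5 + e) / 4) - 5 by field; rewrite ?pnatr_eq0.
by rewrite a0 mulr0 sub0r.
Qed.

Lemma sqrt5_2_neq2 (e : C) : e ^+ 2 = 5 -> (3 + e) / 4 != 2.
Proof.
move=> e5; apply/eqP=> a2; apply: sqr5_neq; rewrite -[RHS]e5; congr (_ ^+ 2).
have -> : e = 4 * ((3 + e) / 4) - 3 by field; rewrite ?pnatr_eq0.
by rewrite a2; ring.
Qed.

Let four_neq0 : (4 : C) != 0.
Proof. by rewrite pnatr_eq0. Qed.

Lemma roots_hex_cubic_0 (l : C) :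
    root (hex_cubic 0) l ->
  [|| l == 0, l == (5 - sqrtC 5) / 4 | l == (5 + sqrtC 5) / 4].
Proof.
rewrite rootE horner_hex_cubic => l0.
have : l * ((l - (5 - sqrtC 5) / 4) * (l - (5 + sqrtC 5) / 4)) = 0.
  apply: (mulfI four_neq0); rewrite mulr0 -[RHS](eqP l0).
  transitivity (l * (4 * l ^+ 2 - 10 * l + (25 - sqrtC 5 ^+ 2) / 4)).
    by field; rewrite ?pnatr_eq0.
  by rewrite sqrtCK; field; rewrite ?pnatr_eq0.
by move/eqP; rewrite !mulf_eq0 !subr_eq0.
Qed.

Lemma roots_hex_cubic_2 (l : C) :
    root (hex_cubic 2) l ->
  [|| l == 2, l == (3 - sqrtC 5) / 4 | l == (3 + sqrtC 5) / 4].
Proof.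
rewrite rootE horner_hex_cubic => l0.
have : (l - 2) * ((l - (3 - sqrtC 5) / 4) * (l - (3 + sqrtC 5) / 4)) = 0.
  apply: (mulfI four_neq0); rewrite mulr0 -[RHS](eqP l0).
  transitivity ((l - 2) * (4 * l ^+ 2 - 6 * l + (9 - sqrtC 5 ^+ 2) / 4)).
    by field; rewrite ?pnatr_eq0.
  by rewrite sqrtCK; field; rewrite ?pnatr_eq0.
by move/eqP; rewrite !mulf_eq0 !subr_eq0.
Qed.

(** The factors of the characteristic polynomial contributed by the inserted
    vertices: the determinant of one path, and the common factor of the Schur
    complement, both at [x = 2 c = 2 (1 - lambda)]. *)
Definition path_poly : {poly C} :=
  (2 * (1 - 'X)) ^+ 4 - 3 * (2 * (1 - 'X)) ^+ 2 + 1.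
Definition mid_poly : {poly C} := (2 * (1 - 'X)) ^+ 2 - 1.

(** The reason why the exceptional eigenvalues are attached to the eigenvalues
    0 and 2 of the original graph. *)
Lemma hex_cubic_mulX :
  path_poly * ('X * ('X - 2%:P)) = hex_cubic 0 * hex_cubic 2.
Proof.
rewrite /path_poly /hex_cubic -!mul_polyC.
rewrite !(rmorphD, rmorphM, rmorphN, rmorph0, rmorph_nat) /=; ring.
Qed.

Lemma half_neq_three_half : (1 / 2 : C) != 3 / 2.
Proof.
by rewrite (inj_eq (mulIf _)) ?invr_eq0 ?pnatr_eq0 // (eqr_nat C 1 3).
Qed.

Lemma mid_polyE : mid_poly = 4 *: (('X - (1 / 2)%:P) * ('X - (3 / 2)%:P)).
Proof.
have two_neq0 : (2 : C) != 0 by rewrite pnatr_eq0.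
have halfP n : 2%:P * (n%:R / 2 : C)%:P = n%:R.
  by rewrite -polyCM mulrCA mulfV // mulr1 rmorph_nat.
transitivity ((2%:P * ('X - (1%:R / 2)%:P)) * (2%:P * ('X - (3 / 2)%:P)) : {poly C}).
  rewrite !mulrBr !halfP /mid_poly !(rmorph_nat) /=; ring.
rewrite -mul_polyC mulrACA -polyCM; congr (_%:P * _); ring.
Qed.

Lemma mup_mid_poly a : mup a mid_poly = ((a == (1 / 2)%R) + (a == (3 / 2)%R))%N.
Proof.
rewrite mid_polyE -mul_polyC mupMr ?rootC ?pnatr_eq0 //.
rewrite mupM ?polyXsubC_eq0 // !(mup_XsubCX 1) ![_ / 2 == a]eq_sym.
by case: eqP; case: eqP.
Qed.

Lemma path_poly0 : path_poly.[0] = 5.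
Proof. by rewrite /path_poly !(hornerE, horner_exp) /=; ring. Qed.

Lemma path_poly2 : path_poly.[2] = 5.
Proof. by rewrite /path_poly !(hornerE, horner_exp) /=; ring. Qed.

Lemma path_poly_neq0 : path_poly != 0.
Proof.
apply/eqP=> p0; have := path_poly0; rewrite p0 horner0 => /esym/eqP.
by rewrite pnatr_eq0.
Qed.

Lemma mup_path_poly a :
  mup a path_poly =
    ([&& a != 0%R, a != 2%R & root (hex_cubic 0%R) a]
     + [&& a != 0%R, a != 2%R & root (hex_cubic 2%R) a])%N.
Proof.
have [->|a0] := eqVneq a 0; first by rewrite mupNroot // rootE path_poly0 pnatr_eq0.
have [->|a2] := eqVneq a 2; first by rewrite mupNroot // rootE path_poly2 pnatr_eq0.
rewrite -!mup_hex_cubic ?realn ?real0 // -mupM ?hex_cubic_neq0 //.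
rewrite -hex_cubic_mulX mupMl //.
by rewrite rootM !rootE !hornerE subr_eq0 negb_or a0.
Qed.

Lemma mup_path_poly_root s a :
    root (hex_cubic s) a ->
  mup a path_poly = ((s == 0%R) && (a != 0%R) + (s == 2%R) && (a != 2%R))%N.
Proof.
move=> sa.
have a0 : a = 0 -> s = 0.
  by move=> a0; apply: hex_cubic_root_inj sa _; rewrite a0 root_hex_cubic_0.
have a2 : a = 2 -> s = 2.
  by move=> a2; apply: hex_cubic_root_inj sa _; rewrite a2 root_hex_cubic_2.
have two_neq0 : (2 : C) == 0 = false by rewrite pnatr_eq0.
rewrite mup_path_poly !(root_hex_cubic_eq _ sa).
congr (nat_of_bool _ + nat_of_bool _)%N.
  case: (eqVneq a 2) => [/a2->|_]; last by rewrite andbC.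
  by rewrite two_neq0 !andbF.
case: (eqVneq a 0) => [/a0->|_]; last by rewrite /= andbC.
by rewrite [0 == 2]eq_sym two_neq0.
Qed.

Lemma mup_mid_poly_root s a :
  root (hex_cubic s) a -> 0 <= s <= 2 -> mup a mid_poly = 0%N.
Proof.
move=> sa s_in; rewrite mup_mid_poly.
have -> : (a == 1 / 2) = false.
  apply/eqP=> def_a; move: s_in; rewrite def_a in sa.
  by rewrite (hex_cubic_root_inj sa root_hex_cubic_half) oppr_ge0 ler10.
have -> // : (a == 3 / 2) = false.
apply/eqP=> def_a; move: s_in; rewrite def_a in sa.
by rewrite (hex_cubic_root_inj sa root_hex_cubic_three_half) ler_nat andbF.
Qed.

End HexCubic.

(** * The multiplicity identity *)

Section HexagonalSpectrum.

Variables (C : numClosedFieldType) (G : sgraph).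
Hypothesis degree_gt0 : forall u : G, (0 < degree u)%N.

Let L := normalized_laplacian C G.
Let LH := normalized_laplacian C (hexagonal G).
Let N := graph_order G.
Let E := graph_size G.

Lemma degree_hexagonal_gt0 (y : hexagonal G) : (0 < degree y)%N.
Proof.
case: y => [u|y]; last by rewrite degree_hexagonal_inr.
by rewrite degree_hexagonal_inl muln_gt0 degree_gt0.
Qed.

(** Multiplicities of [a] on both sides of [idet_pencil_hexagonal], taken with
    [c = 1 - 'X].  Keeping [V^N] on the left avoids a negative exponent when
    the graph is a tree. *)
Lemma eig_mult_hexagonal (a : C) :
  (N * mup a (path_poly C) + eig_mult LH a =
   E * mup a (path_poly C) + N * mup a (mid_poly C)
   + \sum_i root (hex_cubic (spectral_diag L 0%R i)) a)%N.
Proof.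
pose x : {poly C} := 2 * (1 - 'X).
have x_neq0 : x != 0.
  apply/eqP=> /(congr1 (horner^~ 0)) /eqP.
  by rewrite /x !hornerE subr0 mulr1 -[1 + 1]/(2%:R) pnatr_eq0.
have mid_neq0 : mid_poly C != 0.
  by rewrite mid_polyE scaler_eq0 pnatr_eq0 mulf_neq0 ?polyXsubC_eq0.
have deg_neq0 (H : sgraph) :
    (forall u : H, (0 < degree u)%N) -> \prod_(u : H) (degree u)%:R != 0 :> C.
  by move=> H_gt0; apply/prodf_neq0 => u _; rewrite pnatr_eq0 -lt0n.
have factor_H : exists2 k : C, k != 0 &
    idet (@pencil {poly C} (hexagonal G) (1 - 'X) 1) = k%:P * char_poly LH.
  exists ((\prod_(y : hexagonal G) (degree y)%:R) * (-1) ^+ #|hexagonal G|).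
    by rewrite mulf_neq0 ?signr_eq0 ?deg_neq0 //; apply: degree_hexagonal_gt0.
  rewrite (@idet_pencil_spectral C _ degree_hexagonal_gt0) polyCM -mulrA; congr (_ * _).
  have -> : ((-1) ^+ #|hexagonal G|)%:P =
      \prod_(i < #|hexagonal G|) (-1) :> {poly C}.
    by rewrite prodr_const card_ord rmorphXn rmorphN rmorph1.
  rewrite (@char_poly_laplacian C _ degree_hexagonal_gt0) -big_split /=.
  by apply: eq_bigr => i _; ring.
have factor_G : exists2 k : C, k != 0 &
    idet (@pencil {poly C} G (x ^+ 3 - 3 * x) (x ^+ 2 - 2))
      = k%:P * \prod_i hex_cubic (spectral_diag L 0 i).
  exists ((\prod_(u : G) (degree u)%:R) * (- 2) ^+ #|G|).
    by rewrite mulf_neq0 ?deg_neq0 // expf_neq0 // oppr_eq0 pnatr_eq0.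
  rewrite (@idet_pencil_spectral C _ degree_gt0) polyCM -mulrA; congr (_ * _).
  have -> : ((- 2) ^+ #|G|)%:P = \prod_(i < #|G|) (- 2) :> {poly C}.
    by rewrite prodr_const card_ord rmorphXn rmorphN rmorph_nat.
  by rewrite -big_split; apply: eq_bigr => i _; rewrite hex_cubic_pencil.
have [[k k_neq0 kE] [l l_neq0 lE]] := (factor_H, factor_G).
have := idet_pencil_hexagonal G x_neq0 mid_neq0.
rewrite -/x -/(path_poly C) -/(mid_poly C) kE lE => /(congr1 (mup a)).
have prod_neq0 : \prod_i hex_cubic (spectral_diag L 0 i) != 0.
  by apply/prodf_neq0 => i _; apply: hex_cubic_neq0.
have char_neq0 : char_poly LH != 0 by rewrite monic_neq0 ?char_poly_monic.
rewrite !mupM ?mulf_neq0 ?expf_neq0 ?path_poly_neq0 ?polyC_eq0 ?char_neq0 //.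
rewrite ![mup a _%:P]mupNroot ?rootC // !mup_exp ?path_poly_neq0 // !add0n addnC => ->.
congr (_ + _)%N; rewrite mup_prod => [|i]; last exact: hex_cubic_neq0.
apply: eq_bigr => i _; apply: mup_hex_cubic.
have /andP[s_ge0 _] : 0 <= spectral_diag L 0 i <= 2.
  apply: eigenvalue_laplacian_bounds => //.
  by apply/eigenvalue_spectral => //; exists i.
exact: ger0_real.
Qed.

End HexagonalSpectrum.

(** * Connectedness and bipartiteness of hexagonal graphs *)

Section HexagonalConnected.

Variable G : sgraph.

Lemma connected_degree_gt0 :
  is_connected G -> (0 < graph_size G)%N -> forall u : G, (0 < degree u)%N.
Proof.
move=> G_connected /card_gt0P[A /imsetP[[u0 v0]]]; rewrite inE /= => uv0 _ u.
have [->|] := eqVneq u u0; first by apply/card_gt0P; exists v0; rewrite inE.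
have /connectP[[|w p] /=] := G_connected u u0; first by move=> _ ->; rewrite eqxx.
by case/andP=> uw _ _ _; apply/card_gt0P; exists w; rewrite inE.
Qed.

Lemma hexagonal_connected : is_connected G -> is_connected (hexagonal G).
Proof.
move=> G_connected.
pose base (y : hexagonal G) : G :=
  match y with inl u => u | inr (d, _) => (val d).1 end.
have conn_sym : connect_sym (@adj (hexagonal G)).
  by apply/sym_connect_sym/adj_sym.
have to_base y : connect (@adj (hexagonal G)) y (inl (base y)).
  case: y => [u|[d b]]; first exact: connect0.
  have outer : connect (@adj (hexagonal G)) (inr (d, false)) (inl (val d).1).
    by apply: connect1; rewrite /= eqxx.
  case: b => //; apply: connect_trans outer.
  by apply: connect1; rewrite /= eqxx.
have base_path u v : connect (@adj (hexagonal G)) (inl u) (inl v).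
  pose Q w := connect (@adj (hexagonal G)) (inl u) (inl w).
  apply: (connected_propagate G_connected (Q := Q) (connect0 _ _)).
  by move=> w w' ww' /connect_trans; apply; apply: connect1.
move=> y z; apply: connect_trans (to_base y) _.
by apply: connect_trans (base_path _ (base z)) _; rewrite conn_sym.
Qed.

Lemma hexagonal_size_gt0 :
  (0 < graph_size G)%N -> (0 < graph_size (hexagonal G))%N.
Proof.
case/card_gt0P=> A /imsetP[[u v]]; rewrite inE /= => uv _; apply/card_gt0P.
exists [set (inl u : hexagonal G); inl v]; apply/imsetP.
by exists (inl u : hexagonal G, inl v : hexagonal G); rewrite // inE.
Qed.

(** On the path of length 5 between [u] and [v], the two vertices adjacent to
    [u] and [v] take the opposite of the colour of their neighbour, and the two
    middle ones the colour of the nearest end. *)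
Lemma hexagonal_bipartite : bipartite (hexagonal G) <-> bipartite G.
Proof.
split=> [[c c_edge]|[c c_edge]].
  by exists (fun u => c (inl u)) => u v uv; apply: c_edge.
exists (fun y =>
  match y with inl u => c u | inr (d, b) => b (+) ~~ c (val d).1 end).
have edge_inl u d b :
    @hex_adj G (inl u) (inr (d, b)) -> c u != b (+) ~~ c (val d).1.
  by case/andP=> /negbTE-> /eqP->; case: (c u).
case=> [u|[d b]] [v|[d' b']]; first exact: c_edge.
- exact: edge_inl.
- by rewrite adj_sym eq_sym; apply: edge_inl.
case/orP=> [/andP[/eqP<-]|/and3P[-> -> /eqP def_d']].
  by case: b b' (c _) => [] [] [].
have := c_edge _ _ (valP d); rewrite def_d' /=.
by case: (c _) (c _) => [] [].
Qed.

End HexagonalConnected.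

Lemma hexagonal_iter_spec n (G : sgraph) :
    is_connected G -> (0 < graph_size G)%N ->
  [/\ is_connected (hexagonal_iter n G), (0 < graph_size (hexagonal_iter n G))%N
    & bipartite (hexagonal_iter n G) <-> bipartite G].
Proof.
move=> G_connected G_edge; elim: n => // n [IHc IHe IHb]; split.
- exact: hexagonal_connected.
- exact: hexagonal_size_gt0.
by apply: (iff_trans (hexagonal_bipartite _)).
Qed.

(** * Eigenvalues of the hexagonal graph *)

Section HexagonalMultiplicity.

Variables (C : numClosedFieldType) (G : sgraph).
Hypotheses (G_connected : is_connected G) (G_edge : (0 < graph_size G)%N).

Let L := normalized_laplacian C G.
Let LH := normalized_laplacian C (hexagonal G).
Let N := graph_order G.
Let E := graph_size G.
Let degree_gt0 := connected_degree_gt0 G_connected G_edge.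

Lemma vertex_exists : exists u : G, True.
Proof. by case/card_gt0P: G_edge => A /imsetP[[u v] _ _]; exists u. Qed.

Lemma eig_mult_out_of_range s : ~~ (0 <= s <= 2) -> eig_mult L s = 0%N.
Proof.
move=> s_out; apply/eqP; rewrite -leqn0 leqNgt -eigenvalue_eig_mult.
by apply: contra s_out => /eigenvalue_laplacian_bounds; apply.
Qed.

Lemma eig_mult_laplacian2_nonbipartite : ~ bipartite G -> eig_mult L 2 = 0%N.
Proof.
move=> not_bip; apply/eqP; rewrite -leqn0 leqNgt -eigenvalue_eig_mult.
by apply/negP=> /(eigenvalue2_bipartite degree_gt0 G_connected).
Qed.

(** Since the parameter of a cubic is determined by any of its roots, the
    sum over the spectrum in [eig_mult_hexagonal] reduces to one term. *)
Lemma eig_mult_hexagonal_root s a :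
    root (hex_cubic s) a ->
  (N * mup a (path_poly C) + eig_mult LH a =
   E * mup a (path_poly C) + N * mup a (mid_poly C) + eig_mult L s)%N.
Proof.
move=> sa; rewrite (eig_mult_hexagonal degree_gt0); congr (_ + _)%N.
rewrite /L (eig_mult_spectral degree_gt0); apply: eq_bigr => i _.
by rewrite (root_hex_cubic_eq _ sa) eq_sym.
Qed.

Lemma eig_mult_hexagonal_regular s a :
    root (hex_cubic s) a -> 0 <= s <= 2 -> mup a (path_poly C) = 0%N ->
  eig_mult LH a = eig_mult L s.
Proof.
move=> sa s_in a_path; have := eig_mult_hexagonal_root sa.
by rewrite a_path (mup_mid_poly_root sa s_in) !muln0.
Qed.

(** The values 1/2 and 3/2 are roots of the cubics of -1 and 3, which lie
    outside the range of a normalized Laplacian. *)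
Lemma eig_mult_hexagonal_mid s a :
    root (hex_cubic s) a -> ~~ (0 <= s <= 2) -> mup a (mid_poly C) = 1%N ->
  eig_mult LH a = N.
Proof.
move=> sa s_out a_mid; have := eig_mult_hexagonal_root sa.
rewrite a_mid muln1 eig_mult_out_of_range // addn0.
have neq s' : 0 <= s' <= 2 -> (s == s') = false.
  by move=> s'_in; apply: contraNF s_out => /eqP->.
by rewrite (mup_path_poly_root sa) !neq ?lexx ?ler0n // !muln0.
Qed.

Lemma eig_mult_hexagonal_half : eig_mult LH (1 / 2) = N.
Proof.
apply: eig_mult_hexagonal_mid (root_hex_cubic_half C) _ _.
  by rewrite oppr_ge0 ler10.
by rewrite mup_mid_poly eqxx (negbTE (half_neq_three_half C)).
Qed.

Lemma eig_mult_hexagonal_three_half : eig_mult LH (3 / 2) = N.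
Proof.
apply: eig_mult_hexagonal_mid (root_hex_cubic_three_half C) _ _.
  by rewrite ler_nat andbF.
by rewrite mup_mid_poly eqxx eq_sym (negbTE (half_neq_three_half C)).
Qed.

Lemma eig_mult_hexagonal_0 : eig_mult LH 0 = 1%N.
Proof.
have [u _] := vertex_exists.
rewrite (@eig_mult_hexagonal_regular 0) ?root_hex_cubic_0 ?lexx ?ler0n //.
  exact: eig_mult_laplacian0 u.
by rewrite (mup_path_poly_root (root_hex_cubic_0 C)) eqxx eq_sym pnatr_eq0.
Qed.

Lemma eig_mult_hexagonal_2 : eig_mult LH 2 = eig_mult L 2.
Proof.
apply: eig_mult_hexagonal_regular; rewrite ?root_hex_cubic_2 ?lexx ?ler0n //.
by rewrite (mup_path_poly_root (root_hex_cubic_2 C)) eqxx pnatr_eq0.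
Qed.

(** The truncated subtraction is harmless: the identity proved here also shows
    that the order exceeds the size by at most one. *)
Lemma eig_mult_hexagonal_sqrt5_0 (e : C) :
  e ^+ 2 = 5 -> eig_mult LH ((5 + e) / 4) = (E + 1 - N)%N.
Proof.
move=> e5; have sa := root_hex_cubic_sqrt5_0 e5.
have s_in : 0 <= (0 : C) <= 2 by rewrite lexx ler0n.
have [u _] := vertex_exists.
have mult0 : eig_mult L 0 = 1%N by apply: eig_mult_laplacian0 u.
have := eig_mult_hexagonal_root sa.
rewrite (mup_mid_poly_root sa s_in) (mup_path_poly_root sa) mult0 eqxx.
rewrite sqrt5_0_neq0 // [0 == 2]eq_sym pnatr_eq0 /= muln0 !muln1; lia.
Qed.

Lemma eig_mult_hexagonal_sqrt5_2 (e : C) :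
  e ^+ 2 = 5 -> eig_mult LH ((3 + e) / 4) = (E + eig_mult L 2%R - N)%N.
Proof.
move=> e5; have sa := root_hex_cubic_sqrt5_2 e5.
have s_in : 0 <= (2 : C) <= 2 by rewrite lexx ler0n.
have := eig_mult_hexagonal_root sa.
rewrite (mup_mid_poly_root sa s_in) (mup_path_poly_root sa) eqxx.
rewrite sqrt5_2_neq2 // pnatr_eq0 /= muln0 !muln1; lia.
Qed.

Lemma eigenvalue_hexagonal_root s l :
    eigenvalue L s -> s != 0 -> s != 2 -> root (hex_cubic s) l ->
  eigenvalue LH l /\ eig_mult LH l = eig_mult L s.
Proof.
move=> s_eig s0 s2 sl.
suff mult_l : eig_mult LH l = eig_mult L s.
  by rewrite !eigenvalue_eig_mult mult_l -eigenvalue_eig_mult.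
apply: (eig_mult_hexagonal_regular sl).
  exact: eigenvalue_laplacian_bounds s_eig.
by rewrite (mup_path_poly_root sl) (negbTE s0) (negbTE s2).
Qed.

Lemma eigenvalue_hexagonal_cases (l : C) :
    eigenvalue LH l ->
  [\/ l \in [:: 0; 1 / 2; 3 / 2; (5 - sqrtC 5) / 4; (5 + sqrtC 5) / 4;
                (3 - sqrtC 5) / 4; (3 + sqrtC 5) / 4],
      bipartite G /\ l = 2 |
      exists s : C,
        [/\ eigenvalue L s, s != 0, s != 2 & root (hex_cubic s) l]].
Proof.
rewrite eigenvalue_eig_mult => mult_l; have := eig_mult_hexagonal degree_gt0 l.
have [-> | mid_l] := posnP (mup l (mid_poly C)); last first.
  move=> _; apply: Or31; move: mid_l; rewrite mup_mid_poly !inE.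
  by do 2?case: eqP => // _; rewrite ?orbT.
have [-> | path_l] := posnP (mup l (path_poly C)); last first.
  move=> _; apply: Or31; move: path_l; rewrite mup_path_poly !inE.
  case: (eqVneq l 0) => //= l_neq0; case: (eqVneq l 2) => //= l_neq2.
  case: (boolP (root (hex_cubic 0) l)) => [/roots_hex_cubic_0|_] /=.
    by rewrite (negbTE l_neq0) /= => /orP[]->; rewrite ?orbT.
  case: (boolP (root (hex_cubic 2) l)) => [/roots_hex_cubic_2|//] /=.
  by rewrite (negbTE l_neq2) /= => /orP[]->; rewrite ?orbT.
rewrite !muln0 !add0n => sum_l; move: mult_l; rewrite sum_l lt0n sum_nat_eq0.
rewrite negb_forall => /existsP[i]; rewrite /= eqb0 negbK.
have : eigenvalue L (spectral_diag L 0 i).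
  by apply/eigenvalue_spectral => //; exists i.
move: (spectral_diag L 0 i) => s s_eig sl.
have [s0|s_neq0] := eqVneq s 0.
  apply: Or31; move: sl; rewrite s0 !inE.
  by move=> /roots_hex_cubic_0/or3P[]->; rewrite ?orbT.
have [s2|s_neq2] := eqVneq s 2.
  move: sl s_eig; rewrite s2 => /roots_hex_cubic_2/or3P[/eqP->|l_eq|l_eq] s_eig.
  - by apply: Or32; split=> //; apply: eigenvalue2_bipartite s_eig.
  - by apply: Or31; rewrite !inE l_eq !orbT.
  by apply: Or31; rewrite !inE l_eq !orbT.
by apply: Or33; exists s.
Qed.

End HexagonalMultiplicity.

Theorem theorem2p2 (C : numClosedFieldType) (G : sgraph) (n : nat)
  (G_connected : is_connected G) (G_edge : (1 <= graph_size G)%N)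
  (n_ge1 : (1 <= n)%N) :
  let L m := normalized_laplacian C (hexagonal_iter m G) in
  let N m := graph_order (hexagonal_iter m G) in
  let E m := graph_size (hexagonal_iter m G) in
  (forall s : C, eigenvalue (L n.-1) s -> s != 0 -> s != 2 ->
     exists l1 l2 l3 : C,
       hex_cubic s = 4 *: (('X - l1%:P) * ('X - l2%:P) * ('X - l3%:P)) /\
       (forall l, l \in [:: l1; l2; l3] ->
          eigenvalue (L n) l /\ eig_mult (L n) l = eig_mult (L n.-1) s)) /\
  (eig_mult (L n) 0 = 1%N /\ (bipartite G -> eig_mult (L n) 2 = 1%N)) /\
  (eig_mult (L n) (1 / 2) = N n.-1 /\ eig_mult (L n) (3 / 2) = N n.-1) /\
  (eig_mult (L n) ((5 - sqrtC 5) / 4) = (E n.-1 + 1 - N n.-1)%N /\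
   eig_mult (L n) ((5 + sqrtC 5) / 4) = (E n.-1 + 1 - N n.-1)%N) /\
  (bipartite G ->
     eig_mult (L n) ((3 - sqrtC 5) / 4) = (E n.-1 + 1 - N n.-1)%N /\
     eig_mult (L n) ((3 + sqrtC 5) / 4) = (E n.-1 + 1 - N n.-1)%N) /\
  (~ bipartite G ->
     eig_mult (L n) ((3 - sqrtC 5) / 4) = (E n.-1 - N n.-1)%N /\
     eig_mult (L n) ((3 + sqrtC 5) / 4) = (E n.-1 - N n.-1)%N) /\
  (forall l : C, eigenvalue (L n) l ->
     [\/ l \in [:: 0; 1 / 2; 3 / 2; (5 - sqrtC 5) / 4; (5 + sqrtC 5) / 4;
                   (3 - sqrtC 5) / 4; (3 + sqrtC 5) / 4],
         bipartite G /\ l = 2 |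
         exists s : C,
           [/\ eigenvalue (L n.-1) s, s != 0, s != 2 & root (hex_cubic s) l]]).
Proof.
case: n n_ge1 => // n _ L N E.
have [Hc He bip] := hexagonal_iter_spec n G_connected G_edge.
have e2 : sqrtC 5 ^+ 2 = 5 :> C by rewrite sqrtCK.
have Ne2 : (- sqrtC 5) ^+ 2 = 5 :> C by rewrite sqrrN.
have [u _] := vertex_exists He.
have mult2 : bipartite G -> eig_mult (L n) 2 = 1%N.
  by move/bip; apply: eig_mult_laplacian2 u => //; apply: connected_degree_gt0.
split=> [s s_eig s0 s2|].
  have [l1 [l2 [l3 def_s]]] := hex_cubic_split s; exists l1, l2, l3.
  split=> // l l_in; apply: eigenvalue_hexagonal_root => //.
  rewrite def_s -mul_polyC !rootM !root_XsubC.
  by move: l_in; rewrite !inE orbA => ->; rewrite orbT.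
split.
  split; first exact: eig_mult_hexagonal_0.
  by move=> /mult2 m2; rewrite /L eig_mult_hexagonal_2.
split.
  by split; [exact: eig_mult_hexagonal_half | exact: eig_mult_hexagonal_three_half].
split; first by split; apply: eig_mult_hexagonal_sqrt5_0.
split=> [/mult2 m2|].
  by split; rewrite /L eig_mult_hexagonal_sqrt5_2 // m2.
split=> [not_bip|l /(eigenvalue_hexagonal_cases Hc He)[]].
- have m2 : eig_mult (L n) 2 = 0%N.
    by apply: eig_mult_laplacian2_nonbipartite => // /bip.
  by split; rewrite /L eig_mult_hexagonal_sqrt5_2 // m2 addn0.
- exact: Or31.
- by case=> /bip bipG l2; apply: Or32.
exact: Or33.
Qed.
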